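(* Let $\varepsilon>0$ and let $V,W$ be two decomposable extended persistence modules over a field $k$. If $V$ and $W$ are $\varepsilon$-interleaved, then $d_B(V,W)\le \varepsilon$.
   Context: Fix a field $k$. Let $\mathbb{R}^o$ be the poset $\mathbb{R}$ with reversed order; the element of $\mathbb{R}^o$ corresponding to $b\in\mathbb{R}$ is written $\overline{b}$ (so $\overline{b}<\overline{b'}$ iff $b>b'$). Let $\mathbb{E}=\mathbb{R}\cup\{\infty\}\cup\mathbb{R}^o$, totally ordered by the given orders on $\mathbb{R}$ and $\mathbb{R}^o$ and $s<\infty<\overline{t}$ for all $s,t\in\mathbb{R}$. An extended persistence module $V$ is a functor from the poset $\mathbb{E}$ to finite dimensional $k$-vector spaces: vector spaces $V_x$ ($x\in\mathbb{E}$) and linear maps $V_{x,y}:V_x\to V_y$ for $x\le y$ with $V_{x,x}=\mathrm{id}$, $V_{x,z}=V_{y,z}\circ V_{x,y}$. Morphisms, isomorphisms and direct sums are pointwise. For an interval $I\subseteq\mathbb{E}$, the interval module $k_I$ is $k$ at points of $I$, $0$ elsewhere, with identity maps between nonzero spaces. $V$ is decomposable if it is isomorphic to a direct sum of finitely many interval modules over $\mathbb{E}$, none of which has $\infty$ as an endpoint (such a decomposition is unique). Persistence diagrams of a decomposable $V$ (multisets, obtained from the interval decomposition, counting multiplicity, regardless of whether endpoints are included): $\mathrm{Ord}(V)$ on $\mathbb{R}\times\mathbb{R}$ has a point $(a,a')$ for each interval with endpoints $a\le a'$ in $\mathbb{R}$; $\mathrm{Rel}(V)$ on $\mathbb{R}^o\times\mathbb{R}^o$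 has a point $(\overline{b},\overline{b'})$ for each interval with endpoints $\overline{b}\le\overline{b'}$ in $\mathbb{R}^o$; $\mathrm{Ext}(V)$ on $\mathbb{R}\times\mathbb{R}^o$ has a point $(a,\overline{b})$ for each interval with endpoints $a\in\mathbb{R}$ and $\overline{b}\in\mathbb{R}^o$. Only intervals of these three types contribute points. On each plane use the $l^\infty$ distance $d((x,y),(z,w))=\max(|x-z|,|y-w|)$ (elements of $\mathbb{R}^o$ being identified with real numbers). A partial matching between multisets $A,B$ is a bijection between sub-multisets $A'\subset A$, $B'\subset B$; it is perfect if $A'=A$, $B'=B$. For $\delta>0$, a $\delta$-matching between decomposable $V,W$ is a triple $(\phi_O,\phi_R,\phi_E)$ with $\phi_O$ a partial matching between $\mathrm{Ord}(V),\mathrm{Ord}(W)$, $\phi_R$ a partial matching between $\mathrm{Rel}(V),\mathrm{Rel}(W)$, and $\phi_E$ a perfect matching between $\mathrm{Ext}(V),\mathrm{Ext}(W)$, such that all matched pairs are at distance at most $\delta$ and all unmatched points are at distance at most $\delta$ from the diagonal of their plane. The bottleneck distance is $d_B(V,W)=\inf\{\delta>0: V,W \text{ are } \delta\text{-matched}\}$ (with $\inf\varnothing=+\infty$). For $\varepsilon>0$, an $\varepsilon$-interleaving between $V,W$ consists of linear maps $\varphi_a:V_a\to W_{a+\varepsilon}$, $\varphi_{\overline{b}}:V_{\overline{b}}\to W_{\overline{b-\varepsilon}}$, $\psi_a:W_a\to V_{a+\varepsilon}$, $\psi_{\overline{b}}:W_{\overline{b}}\to V_{\overline{b-\varepsilon}}$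 for all $a\in\mathbb{R}$, $\overline{b}\in\mathbb{R}^o$ such that: (i) for all $a<a'$ in $\mathbb{R}$ and $\overline{b}<\overline{b'}$ in $\mathbb{R}^o$, $W_{a+\varepsilon,a'+\varepsilon}\circ\varphi_a=\varphi_{a'}\circ V_{a,a'}$, $W_{a+\varepsilon,\overline{b-\varepsilon}}\circ\varphi_a=\varphi_{\overline{b}}\circ V_{a,\overline{b}}$, $W_{\overline{b-\varepsilon},\overline{b'-\varepsilon}}\circ\varphi_{\overline{b}}=\varphi_{\overline{b'}}\circ V_{\overline{b},\overline{b'}}$; (i') the same with $V,W$ exchanged and $\varphi$ replaced by $\psi$; (ii) $\psi_{a+\varepsilon}\circ\varphi_a=V_{a,a+2\varepsilon}$ and $\psi_{\overline{b-\varepsilon}}\circ\varphi_{\overline{b}}=V_{\overline{b},\overline{b-2\varepsilon}}$; (ii') the same with the roles of $(V,\varphi)$ and $(W,\psi)$ reversed. $V,W$ are $\varepsilon$-interleaved if an $\varepsilon$-interleaving exists. *)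

(* Defs.v *)
From HB Require Import structures.
From mathcomp Require Import all_boot all_order all_algebra.
From mathcomp Require Import all_classical all_reals ereal.

Set Implicit Arguments.
Unset Strict Implicit.
Unset Printing Implicit Defensive.

Import Order.TTheory GRing.Theory Num.Theory.

Local Open Scope classical_set_scope.
Local Open Scope ring_scope.

(* The extended line R u {oo} u R^o; [Rev b] is the point b-bar of R^o. *)
Inductive eline (R : realType) := Fin of R | Infty | Rev of R.

Arguments Infty {R}.

Section ElineOrder.
Variable R : realType.

Let encode (x : eline R) : R + unit + R :=
  match x with
  | Fin a => inl (inl a) | Infty => inl (inr tt) | Rev b => inr b
  end.

Let decode (y : R + unit + R) : eline R :=
  match y with
  | inl (inl a) => Fin a | inl (inr _) => Infty | inr b => Rev b
  end.

Let encodeK : cancel encode decode. Proof. by case. Qed.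

HB.instance Definition _ := Choice.copy (eline R) (can_type encodeK).

Definition eline_le (x y : eline R) : bool :=
  match x, y with
  | Fin a, Fin a' => a <= a'
  | Fin _, (Infty | Rev _) => true
  | Infty, Fin _ => false
  | Infty, (Infty | Rev _) => true
  | Rev _, (Fin _ | Infty) => false
  | Rev b, Rev b' => b' <= b
  end.

Fact eline_le_refl : reflexive eline_le.
Proof. by case=> //= a; exact: lexx. Qed.

Fact eline_le_anti : antisymmetric eline_le.
Proof.
by case=> [a||b] [a'||b'] //= /le_anti-> //.
Qed.

Fact eline_le_trans : transitive eline_le.
Proof.
case=> [y||y] [x||x] [z||z] //=; first exact: le_trans.
by move=> yx zy; exact: le_trans zy yx.
Qed.

Fact eline_le_total : total eline_le.
Proof. by case=> [a||b] [a'||b'] //=; exact: le_total. Qed.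

Fact eline_display : Order.disp_t. Proof. exact: Order.Disp tt tt. Qed.

HB.instance Definition _ := Order.Le_isPOrder.Build eline_display (eline R)
  eline_le_refl eline_le_anti eline_le_trans.

HB.instance Definition _ :=
  Order.POrder_isTotal.Build eline_display (eline R) eline_le_total.

Lemma le_FinE (a a' : R) : (Fin a <= Fin a')%O = (a <= a').
Proof. by []. Qed.

Lemma le_FinRev (a b : R) : (Fin a <= Rev b)%O.
Proof. by []. Qed.

Lemma le_RevE (b b' : R) : (Rev b <= Rev b')%O = (b' <= b).
Proof. by []. Qed.

Lemma le_Fin_shift (eps a a' : R) :
  (Fin a <= Fin a')%O -> (Fin (a + eps) <= Fin (a' + eps))%O.
Proof. by rewrite !le_FinE lerD2r. Qed.

Lemma le_Rev_shift (eps b b' : R) :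
  (Rev b <= Rev b')%O -> (Rev (b - eps) <= Rev (b' - eps))%O.
Proof. by rewrite !le_RevE lerD2r. Qed.

Lemma le_Fin_shift2 (eps a : R) :
  0 < eps -> (Fin a <= Fin (a + eps + eps))%O.
Proof. by move=> /ltW e0; rewrite le_FinE -addrA lerDl addr_ge0. Qed.

Lemma le_Rev_shift2 (eps b : R) :
  0 < eps -> (Rev b <= Rev (b - eps - eps))%O.
Proof. by move=> /ltW e0; rewrite le_RevE -addrA gerDl -opprD oppr_le0 addr_ge0. Qed.

End ElineOrder.

Section PersistenceModules.
Variables (k : fieldType) (R : realType).
Local Notation E := (eline R).

Record pmodule := PModule {
  pspace :> E -> vectType k;
  ptrans : forall x y : E, (x <= y)%O -> 'Hom(pspace x, pspace y);
  ptrans_id : forall (x : E) (h : (x <= x)%O), ptrans h = \1%VF;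
  ptrans_comp : forall (x y z : E) (hxy : (x <= y)%O) (hyz : (y <= z)%O)
    (hxz : (x <= z)%O), ptrans hxz = (ptrans hyz \o ptrans hxy)%VF }.

Definition is_pmorphism (V W : pmodule) (f : forall x : E, 'Hom(V x, W x)) :=
  forall (x y : E) (h : (x <= y)%O), (ptrans W h \o f x = f y \o ptrans V h)%VF.

Definition pisomorphic (V W : pmodule) :=
  exists f : forall x : E, 'Hom(V x, W x),
    is_pmorphism f /\ forall x, bijective (f x).

(* [k_I] at [x] is k^1 if [x \in I] and k^0 otherwise, the boolean [x \in I]
   being read as a number; [pid_mx 1] is then the 1 x 1 identity matrix
   between nonzero spaces and the empty matrix otherwise. *)
Section IntervalModule.
Variable I : interval E.

Definition itv_space (x : E) : vectType k := 'rV[k]_(x \in I).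

Definition itv_map (x y : E) (_ : (x <= y)%O) : 'Hom(itv_space x, itv_space y) :=
  linfun (mulmxr (pid_mx 1 : 'M[k]_(x \in I, y \in I))).

Fact itv_map_id (x : E) (h : (x <= x)%O) : itv_map h = \1%VF.
Proof.
apply/lfunP => v; rewrite id_lfunE lfunE /=.
by rewrite [pid_mx 1](_ : _ = 1%:M) ?mulmx1 //; apply/matrixP => i j;
  rewrite !mxE; case: (x \in I) i j => [|] i j; [rewrite !ord1 | case: i].
Qed.

Fact itv_map_comp (x y z : E) (hxy : (x <= y)%O) (hyz : (y <= z)%O)
  (hxz : (x <= z)%O) : itv_map hxz = (itv_map hyz \o itv_map hxy)%VF.
Proof.
apply/lfunP => v; rewrite comp_lfunE !lfunE /= -mulmxA mul_pid_mx.
congr (v *m _).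
have [xI|xI] := boolP (x \in I); last by apply/matrixP => -[].
have [zI|zI] := boolP (z \in I); last by apply/matrixP => ? [].
suff yI : y \in I by rewrite yI.
move: xI zI; case: I => l u; rewrite !itv_boundlr => /andP[lx _] /andP[_ zu].
rewrite (le_trans lx) ?(le_trans _ zu) //.
Qed.

Definition itv_module : pmodule := PModule itv_map_id itv_map_comp.

End IntervalModule.

Definition zero_module : pmodule :=
  @PModule (fun=> 'rV[k]_0) (fun _ _ _ => \1%VF) (fun _ _ => erefl)
    (fun _ _ _ _ _ _ => esym (comp_lfun1l _)).

Section DirectSum.
Variables V W : pmodule.

Definition sum_space (x : E) : vectType k := (V x * W x)%type.

Definition sum_fun (x y : E) (h : (x <= y)%O) (u : V x * W x) : V y * W y :=
  (ptrans V h u.1, ptrans W h u.2).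

Fact sum_fun_linear (x y : E) (h : (x <= y)%O) : linear (sum_fun h).
Proof. by move=> a u v; rewrite /sum_fun /= !linearP. Qed.

HB.instance Definition _ (x y : E) (h : (x <= y)%O) :=
  GRing.isLinear.Build k (V x * W x)%type (V y * W y)%type *:%R (sum_fun h)
    (sum_fun_linear h).

Definition sum_map (x y : E) (h : (x <= y)%O) :
    'Hom(sum_space x, sum_space y) :=
  linfun (sum_fun h).

Fact sum_map_id (x : E) (h : (x <= x)%O) : sum_map h = \1%VF.
Proof.
by apply/lfunP => -[u v]; rewrite lfunE /= /sum_fun /= !ptrans_id !id_lfunE.
Qed.

Fact sum_map_comp (x y z : E) (hxy : (x <= y)%O) (hyz : (y <= z)%O)
  (hxz : (x <= z)%O) : sum_map hxz = (sum_map hyz \o sum_map hxy)%VF.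
Proof.
apply/lfunP => -[u v]; rewrite comp_lfunE !lfunE /= /sum_fun /=.
by rewrite !(ptrans_comp _ hxy hyz) !comp_lfunE.
Qed.

Definition sum_module : pmodule := PModule sum_map_id sum_map_comp.

End DirectSum.

Definition big_sum_module (Vs : seq pmodule) : pmodule :=
  foldr sum_module zero_module Vs.

End PersistenceModules.

Section Decomposition.
Variables (k : fieldType) (R : realType).
Local Notation E := (eline R).

Definition Infty_free (I : interval E) : Prop :=
  let: Interval l u := I in
  (forall c, l <> BSide c Infty) /\ (forall c, u <> BSide c Infty).

(* The order on [eline R] is dense, conditionally complete and without extrema,
   so every nonempty convex subset is [x \in I] for exactly one [I], whose
   bounds carry its endpoints; a bound -oo or +oo stands for an interval
   unbounded on that side. *)
Definition is_decomposition (V : pmodule k R) (B : seq (interval E)) : Prop :=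
  (forall I, I \in B -> (exists x, x \in I) /\ Infty_free I) /\
  pisomorphic V (big_sum_module [seq itv_module k J | J <- B]).

Definition decomposable (V : pmodule k R) : Prop :=
  exists B, is_decomposition V B.

(* The multiset of intervals of a decomposition of [V], which is unique up to
   reordering; the empty one if [V] is not decomposable. *)
Definition barcode (V : pmodule k R) : seq (interval E) :=
  xget [::] [set B | is_decomposition V B].

Definition ord_point (I : interval E) : option (R * R) :=
  if I is Interval (BSide _ (Fin a)) (BSide _ (Fin a')) then Some (a, a')
  else None.

Definition rel_point (I : interval E) : option (R * R) :=
  if I is Interval (BSide _ (Rev b)) (BSide _ (Rev b')) then Some (b, b')
  else None.

Definition ext_point (I : interval E) : option (R * R) :=
  if I is Interval (BSide _ (Fin a)) (BSide _ (Rev b)) then Some (a, b)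
  else None.

(* Multisets are represented by sequences, taken up to [perm_eq]. *)
Definition Ord V : seq (R * R) := pmap ord_point (barcode V).
Definition Rel V : seq (R * R) := pmap rel_point (barcode V).
Definition Ext V : seq (R * R) := pmap ext_point (barcode V).

End Decomposition.

Section Bottleneck.
Variable R : realType.

Definition dist_linf (p q : R * R) : R :=
  Num.max `|p.1 - q.1| `|p.2 - q.2|.

Definition dist_diag (p : R * R) : R :=
  inf [set dist_linf p (z, z) | z in [set: R]].

(* A bijection between sub-multisets of [A] and [B] is given by its graph,
   a multiset of pairs; the other two fields are the unmatched points. *)
Record pmatching (A B : seq (R * R)) := PMatching {
  matched : seq ((R * R) * (R * R));
  unmatchedl : seq (R * R);
  unmatchedr : seq (R * R);
  pmatchingl : perm_eq A (unzip1 matched ++ unmatchedl);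
  pmatchingr : perm_eq B (unzip2 matched ++ unmatchedr) }.

Definition perfect A B (m : pmatching A B) : Prop :=
  unmatchedl m = [::] /\ unmatchedr m = [::].

Definition within (delta : R) A B (m : pmatching A B) : Prop :=
  [/\ forall pq, pq \in matched m -> dist_linf pq.1 pq.2 <= delta,
      forall p, p \in unmatchedl m -> dist_diag p <= delta
    & forall q, q \in unmatchedr m -> dist_diag q <= delta].

Variable k : fieldType.

Definition delta_matched (delta : R) (V W : pmodule k R) : Prop :=
  exists (mO : pmatching (Ord V) (Ord W)) (mR : pmatching (Rel V) (Rel W))
         (mE : pmatching (Ext V) (Ext W)),
    [/\ perfect mE, within delta mO, within delta mR & within delta mE].

Definition bottleneck (V W : pmodule k R) : \bar R :=
  ereal_inf [set delta%:E | delta in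
    [set delta : R | 0 < delta /\ delta_matched delta V W]].

End Bottleneck.

Section Interleaving.
Variables (k : fieldType) (R : realType).
Local Notation E := (eline R).

(* In the conditions below, the order hypotheses [h], [h'] on which the maps
   [ptrans] depend always hold (for [eps > 0]): see [le_Fin_shift], [le_FinRev],
   [le_Rev_shift], [le_Fin_shift2], [le_Rev_shift2]. Being boolean, they have a
   unique proof. *)
Record shift_map (eps : R) (V W : pmodule k R) := ShiftMap {
  shF : forall a : R, 'Hom(V (Fin a), W (Fin (a + eps)));
  shR : forall b : R, 'Hom(V (Rev b), W (Rev (b - eps)));
  shFF : forall (a a' : R) (h : (Fin a <= Fin a')%O)
      (h' : (Fin (a + eps) <= Fin (a' + eps))%O), (Fin a < Fin a')%O ->
    (ptrans W h' \o shF a = shF a' \o ptrans V h)%VF;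
  shFR : forall (a b : R) (h : (Fin a <= Rev b)%O)
      (h' : (Fin (a + eps) <= Rev (b - eps))%O),
    (ptrans W h' \o shF a = shR b \o ptrans V h)%VF;
  shRR : forall (b b' : R) (h : (Rev b <= Rev b')%O)
      (h' : (Rev (b - eps) <= Rev (b' - eps))%O), (Rev b < Rev b')%O ->
    (ptrans W h' \o shR b = shR b' \o ptrans V h)%VF }.

Definition shift_inverse (eps : R) (V W : pmodule k R)
    (phi : shift_map eps V W) (psi : shift_map eps W V) : Prop :=
  (forall (a : R) (h : (Fin a <= Fin (a + eps + eps))%O),
    (shF psi (a + eps) \o shF phi a)%VF = ptrans V h) /\
  (forall (b : R) (h : (Rev b <= Rev (b - eps - eps))%O),
    (shR psi (b - eps) \o shR phi b)%VF = ptrans V h).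

Definition interleaved (eps : R) (V W : pmodule k R) : Prop :=
  exists (phi : shift_map eps V W) (psi : shift_map eps W V),
    shift_inverse phi psi /\ shift_inverse psi phi.

End Interleaving.

(* Main.v *)
From HB Require Import structures.
Require Import Defs.
From mathcomp Require Import all_boot all_order all_algebra.
From mathcomp Require Import all_classical all_reals ereal.
From mathcomp Require Import lra zify.

(** Write S for the shift of the extended line that adds eps to Fin a, subtracts
it from b in Rev b and fixes Infty. In bases adapted to the interval
decompositions, an interleaving morphism is a family of matrices p_x, indexed by
the finite points x, whose entry at bars I, J vanishes unless x lies in I and S
x in J. Naturality makes the entry constant on the set of these x, so the family
is described by one matrix P ([coefE]); and P(I, J) <> 0 forces both endpoints
of J to lie at most eps to the right of those of I ([coef_lower], [coef_upper]).
In particular the endpoints of J cannot be in a later part of the line than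
those of I: if I and I' are of the same kind (ordinary, relative or extended)
and P(I, J) Q(J, I') <> 0, then J is of that kind as well. The three kinds can
therefore be matched separately.

Fix a kind, let l and u be the endpoint coordinates for which S is the
translation by eps, and call a bar long if u - l > 2 eps; all extended bars
count as long. Let X be a set of long bars of V. If I, I' are in X and l + u <=
l' + u', then every J with P(I, J) Q(J, I') <> 0 is eps-close to I or to I'
([close_left_or_right]); and if such a J exists, or if I = I', there is a point
x of I with S (S x) in I' ([long_overlap]), at which the entry (I, I') of the
identity psi o phi = V_(x, SSx) can be read off. Hence, summing only over the
bars J close to some element of X, (P Q)(I, I') is the Kronecker symbol whenever
l + u <= l' + u'. This unitriangularity makes the rank of P at least #|X|, so at
least #|X| bars of W are close to elements of X ([card_long_bars]).

That is the condition of Hall's theorem, and it holds symmetrically for the long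
bars of W. The theorem of Mendelsohn and Dulmage merges the two resulting
matchings into one that covers the long bars of both sides ([two_sided_hall]).
The bars left over are short, that is, within eps of the diagonal; no extended
bar is left over. So V and W are eps-matched. *)

Set Implicit Arguments.
Unset Strict Implicit.
Unset Printing Implicit Defensive.

Import Order.TTheory GRing.Theory Num.Theory.
(* Of the names shared with classical sets, those of finite sets are meant. *)
Import mathcomp.boot.fintype mathcomp.boot.finset.

Local Open Scope ring_scope.

(** * Bipartite matchings *)

Section Matchings.
Variables T U : finType.
Implicit Types (E M : {set T * U}) (r : T -> U -> bool).

Definition nbrs r (X : {set T}) : {set U} := [set j | [exists i in X, r i j]].

Definition matching M :=
  {in M &, injective (@fst T U)} /\ {in M &, injective (@snd T U)}.

Local Notation edge E := (fun i j => (i, j) \in E).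

Lemma nbrsP r (X : {set T}) j :
  reflect (exists2 i, i \in X & r i j) (j \in nbrs r X).
Proof. by rewrite inE; apply: (iffP exists_inP). Qed.

(** Hall's theorem in the form of Rado: in a minimal edge set satisfying Hall's
condition every vertex of A has a single neighbour. If (i, j1) and (i, j2) were
two edges, removing either one would break the condition on some X1, resp. X2,
both containing i; then submodularity of the number of neighbours contradicts
the condition for X1 :|: X2 and (X1 :&: X2) :\ i. *)
Lemma hall_edges E (A : {set T}) :
  (forall X : {set T}, X \subset A -> (#|X| <= #|nbrs (edge E) X|)%N) ->
  exists M, [/\ matching M, M \subset E & A \subset fst @: M].
Proof.
have [n] := ubnP #|E|; elim: n E => // n IHn E; rewrite ltnS => leEn hallE.
have [/exists_inP[e eE /forall_inP hallEe]|] := boolP [exists e in E,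
    [forall (X : {set T} | X \subset A), (#|X| <= #|nbrs (edge (E :\ e)) X|)%N]].
  have [|M [mM sM cM]] := IHn (E :\ e) _ hallEe.
    by rewrite (leq_trans _ leEn) // (cardsD1 e E) eE.
  by exists M; split=> //; apply: subset_trans sM (subD1set _ _).
move=> /exists_inPn minE.
have tight e : e \in E -> exists X : {set T}, [/\ X \subset A, e.1 \in X
    & (#|nbrs (edge (E :\ e)) X| < #|X|)%N].
  move=> eE; have /forall_inPn[X XA] := minE e eE; rewrite -ltnNge => ltX.
  exists X; split=> //; apply: contraLR ltX => eX.
  rewrite -leqNgt (leq_trans (hallE X XA)) ?subset_leq_card //.
  apply/subsetP => j /nbrsP[i iX /= ijE]; apply/nbrsP; exists i => //.
  by rewrite /= !inE ijE andbT; apply: contraNneq eX => <-.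
have Einj e1 e2 : e1 \in E -> e2 \in E -> e1.1 = e2.1 -> e1 = e2.
  case: e1 e2 => [i j1] [i2 j2] e1E e2E /= Ei; subst i2.
  apply/eqP; apply/negPn/negP => ne12.
  have [X1 [X1A /= iX1 lt1]] := tight _ e1E.
  have [X2 [X2A /= iX2 lt2]] := tight _ e2E.
  set N1 := nbrs _ X1 in lt1; set N2 := nbrs _ X2 in lt2.
  have leU : (#|X1 :|: X2| <= #|N1 :|: N2|)%N.
    apply: leq_trans (hallE _ _) (subset_leq_card _).
      by rewrite subUset X1A.
    apply/subsetP => j /nbrsP[i' i'X /= ijE]; rewrite inE.
    have [e1' | ne1] := eqVneq (i', j) (i, j1).
      apply/orP; right; apply/nbrsP; exists i => //.
      by case: e1' => _ ->; rewrite /= !inE ne12.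
    have [e2' | ne2] := eqVneq (i', j) (i, j2).
      apply/orP; left; apply/nbrsP; exists i => //.
      by case: e2' => _ ->; rewrite /= !inE eq_sym ne12.
    by case/setUP: i'X => i'X; apply/orP; [left | right]; apply/nbrsP;
      exists i' => //; rewrite /= !inE ?ne1 ?ne2.
  have leI : (#|(X1 :&: X2) :\ i| <= #|N1 :&: N2|)%N.
    apply: leq_trans (hallE _ _) (subset_leq_card _).
      by rewrite (subset_trans (subD1set _ _)) // subIset // X1A.
    apply/subsetP => j /nbrsP[i' /setD1P[i'i /setIP[i'X1 i'X2]] /= ijE].
    by rewrite inE; apply/andP; split; apply/nbrsP; exists i' => //;
      rewrite /= !inE ijE andbT; apply: contraNneq i'i => -[->].
  have := cardsUI X1 X2; have := cardsUI N1 N2.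
  by have := cardsD1 i (X1 :&: X2); rewrite inE iX1 iX2 /=; lia.
exists [set e in E | e.1 \in A]; split.
- split=> -[i1 j1] [i2 j2]; rewrite !inE /= => /andP[e1E i1A] /andP[e2E i2A] /=.
    exact: (Einj (_, _) (_, _)) e1E e2E.
  move=> Ej; subst j2; congr (_, _); apply/eqP/negPn/negP => ne12.
  have: (#|[set i1; i2]| <= #|[set j1]|)%N.
    apply: leq_trans (hallE _ _) (subset_leq_card _).
      by apply/subsetP => i /set2P[] ->.
    apply/subsetP => j /nbrsP[i /set2P[] -> /= ijE]; rewrite inE.
      by have [->] := Einj _ _ ijE e1E erefl.
    by have [->] := Einj _ _ ijE e2E erefl.
  by rewrite cards1 cards2 ne12.
- by apply/subsetP => e; rewrite inE => /andP[].
apply/subsetP => i iA; have: (#|[set i]| <= #|nbrs (edge E) [set i]|)%N.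
  by apply: hallE; rewrite sub1set.
rewrite cards1 => /card_gt0P[j /nbrsP[_ /set1P-> /= ijE]].
by apply/imsetP; exists (i, j) => //; rewrite inE ijE.
Qed.

Theorem hall r (A : {set T}) :
  (forall X : {set T}, X \subset A -> (#|X| <= #|nbrs r X|)%N) ->
  exists M, [/\ matching M, {in M, forall e, r e.1 e.2} & A \subset fst @: M].
Proof.
move=> hallr; have [X /hallr|M [mM sM cM]] := @hall_edges [set e | r e.1 e.2] A.
  rewrite (_ : nbrs r X = nbrs (edge [set e | r e.1 e.2]) X) //.
  by apply/setP => j; apply/nbrsP/nbrsP => -[i iX]; [|rewrite /= inE];
    exists i => //; rewrite /= inE.
by exists M; split=> // e /(subsetP sM); rewrite inE.
Qed.

(** The vertices that are to use their M1-edge: a vertex of A that M2 misses has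
no other choice, and an M1-edge so used takes its right end away from the
M2-edge ending there, whose left end must then use M1 in turn. *)
Inductive redirected (A : {set T}) M1 M2 : T -> Prop :=
| redirected_start i of i \in A & i \notin fst @: M2 : redirected A M1 M2 i
| redirected_step i i' j of redirected A M1 M2 i & (i, j) \in M1
    & (i', j) \in M2 : redirected A M1 M2 i'.

(** As in the proof of the Cantor-Bernstein theorem, [redirected] vertices use
M1 and all others use M2; [redirected_step] keeps the right ends distinct. *)
Lemma mendelsohn_dulmage (A : {set T}) (B : {set U}) M1 M2 :
  matching M1 -> A \subset fst @: M1 -> matching M2 -> B \subset snd @: M2 ->
  exists M, [/\ matching M, M \subset M1 :|: M2, A \subset fst @: M
                & B \subset snd @: M].
Proof.
move=> [fst1 snd1] cA [fst2 snd2] cB; pose C := redirected A M1 M2.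
pose M := [set e in M1 | `[< C e.1 >]] :|: [set e in M2 | ~~ `[< C e.1 >]].
have MP e : reflect (e \in M1 /\ C e.1 \/ e \in M2 /\ ~ C e.1) (e \in M).
  rewrite !inE; apply: (iffP orP).
    by case=> /andP[eM]; [move/asboolP; left | move/asboolPn; right].
  by case=> -[eM Ce]; [left | right]; rewrite eM; [apply/asboolP|apply/asboolPn].
exists M; split.
- split=> e1 e2 /MP[] [e1M C1] /MP[] [e2M C2] Ee.
  + exact: fst1.
  + by case: C2; rewrite -Ee.
  + by case: C1; rewrite Ee.
  + exact: fst2.
  + exact: snd1.
  + case: e1 e2 e1M C1 e2M C2 Ee => [i j] [i' j'] /= e1M C1 e2M C2 Ee; subst j'.
    by case: C2; apply: redirected_step C1 e1M e2M.
  + case: e1 e2 e1M C1 e2M C2 Ee => [i j] [i' j'] /= e1M C1 e2M C2 Ee; subst j'.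
    by case: C1; apply: redirected_step C2 e2M e1M.
  + exact: snd2.
- by apply/subsetP => e /MP[] [eM _]; rewrite inE eM ?orbT.
- apply/subsetP => i iA; have [Ci | nCi] := pselect (C i).
    have /imsetP[e eM Ei] := subsetP cA i iA.
    by rewrite Ei; apply/imset_f/MP; left; rewrite -Ei.
  have /imsetP[e eM Ei] : i \in fst @: M2.
    by apply/negPn/negP => iM2; apply: nCi; apply: redirected_start.
  by rewrite Ei; apply/imset_f/MP; right; rewrite -Ei.
apply/subsetP => j jB; have /imsetP[[i' j'] e2M /= Ej] := subsetP cB j jB.
subst j'; have [Ci | nCi] := pselect (C i'); last first.
  by apply/imsetP; exists (i', j) => //; apply/MP; right.
case: Ci e2M => [i iA iM2 e2M | i {}i' j' Ci e1M e2M' e2M].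
  by case/imsetP: iM2; exists (i, j).
have [->] := fst2 _ _ e2M e2M' erefl.
by apply/imsetP; exists (i, j') => //; apply/MP; left.
Qed.

End Matchings.

Lemma matching_swap (T U : finType) (M : {set U * T}) :
  matching M -> matching [set e : T * U | (e.2, e.1) \in M].
Proof.
move=> [fst_inj snd_inj]; split=> -[i j] [i' j']; rewrite !inE /= => eM eM' Ee.
  by subst i'; have [->] := snd_inj _ _ eM eM' erefl.
by subst j'; have [->] := fst_inj _ _ eM eM' erefl.
Qed.

Theorem two_sided_hall (T U : finType) (r : T -> U -> bool)
    (A : {set T}) (B : {set U}) :
  (forall X : {set T}, X \subset A -> (#|X| <= #|nbrs r X|)%N) ->
  (forall Y : {set U}, Y \subset B -> (#|Y| <= #|nbrs (fun j i => r i j) Y|)%N) ->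
  exists M : {set T * U}, [/\ matching M, {in M, forall e, r e.1 e.2},
    A \subset fst @: M & B \subset snd @: M].
Proof.
move=> /hall[M1 [mM1 rM1 cA]] /hall[M2 [mM2 rM2 cB]].
have [|M [mM /subsetP sM cAM cBM]] :=
    mendelsohn_dulmage (B := B) mM1 cA (matching_swap mM2).
  apply/subsetP => j /(subsetP cB)/imsetP[[j' i] eM ->].
  by apply/imsetP; exists (i, j') => //; rewrite inE.
exists M; split=> // e /sM; rewrite !inE => /orP[/rM1 // | /rM2 //].
Qed.

(** * A rank bound for unitriangular products *)

(** If #|Y| < #|X|, the restriction of P to X and Y kills a nonzero row vector v
on the left. Evaluating v P Q = 0 at an index of the support of v with maximal
alpha leaves the coefficient of v at that index, by unitriangularity. *)
Lemma card_le_unitriangular (F : fieldType) (T U : finType) (d : Order.disp_t)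
    (O : orderType d) (alpha : T -> O) (X : {set T}) (Y : {set U})
    (P : T -> U -> F) (Q : U -> T -> F) :
  {in X &, forall i i', (alpha i <= alpha i')%O ->
    \sum_(j in Y) P i j * Q j i' = (i == i')%:R} ->
  (#|X| <= #|Y|)%N.
Proof.
move=> triPQ; rewrite leqNgt; apply/negP => ltYX.
pose M := \matrix_(a < #|X|, b < #|Y|) P (enum_val a) (enum_val b).
pose N := \matrix_(b < #|Y|, a < #|X|) Q (enum_val b) (enum_val a).
have /rowV0Pn[v /sub_kermxP vM0 v0] : kermx M != 0.
  by rewrite kermx_eq0 /row_free neq_ltn (leq_ltn_trans (rank_leq_col _)).
have /rV0Pn[a0 va0] := v0.
case: (@Order.TotalTheory.arg_maxP _ _ _ a0 (fun a => v 0 a != 0)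
  (fun a => alpha (enum_val a)) va0) => a va amax.
case/eqP: va; transitivity ((v *m M *m N) 0 a); last first.
  by rewrite vM0 mul0mx mxE.
rewrite -mulmxA mxE (bigD1 a) //= big1 => [|b nba].
  rewrite addr0 mxE (eq_bigr (fun j => P (enum_val a) (enum_val j)
    * Q (enum_val j) (enum_val a))); last by move=> j _; rewrite !mxE.
  by rewrite -(big_enum_val (fun j => P (enum_val a) j * Q j (enum_val a)))
    triPQ ?enum_valP // eqxx mulr1.
have [-> | vb] := eqVneq (v 0 b) 0; first by rewrite mul0r.
rewrite mxE (eq_bigr (fun j => P (enum_val b) (enum_val j)
    * Q (enum_val j) (enum_val a))); last by move=> j _; rewrite !mxE.
rewrite -(big_enum_val (fun j => P (enum_val b) j * Q j (enum_val a))).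
rewrite triPQ ?enum_valP ?(inj_eq enum_val_inj) ?(negPf nba) ?mulr0 //.
exact: amax.
Qed.

(** * The extended line and its shifts *)

Section Line.
Variable R : realType.
Implicit Types (e : R) (x y z w : eline R) (b : itv_bound (eline R)).

Definition shift e x : eline R :=
  match x with
  | Fin a => Fin (a + e) | Infty => Infty | Rev b => Rev (b - e)
  end.

Lemma shiftK e : cancel (shift e) (shift (- e)).
Proof. by case=> [a||a] //=; rewrite ?addrK // opprK subrK. Qed.

Lemma shift_le e : {mono shift e : x y / (x <= y)%O}.
Proof. by case=> [a||a] [c||c] //; rewrite /= ?le_FinE ?le_RevE lerD2r. Qed.

Lemma shift_lt e : {mono shift e : x y / (x < y)%O}.
Proof. exact: leW_mono (shift_le e). Qed.

Lemma shift_Infty e x : (shift e x != Infty) = (x != Infty).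
Proof. by case: x. Qed.

Lemma le_shift e x : 0 <= e -> (x <= shift e x)%O.
Proof.
by case: x => [a||a] e0 //; rewrite /= ?le_FinE ?le_RevE; lra.
Qed.

Lemma lt_RevE (a c : R) : (Rev a < Rev c)%O = (c < a).
Proof. by rewrite !ltNge le_RevE. Qed.

Lemma lt_FinE (a c : R) : (Fin a < Fin c)%O = (a < c).
Proof. by rewrite !ltNge le_FinE. Qed.

Lemma finite_between x y : (x < y)%O ->
  exists w, [/\ w != Infty, (x < w)%O & (w < y)%O].
Proof.
case: x y => [a||a] [c||c] //; rewrite ?lt_FinE ?lt_RevE => ac.
- by exists (Fin ((a + c) / 2)); split=> //; rewrite lt_FinE; lra.
- by exists (Fin (a + 1)); split=> //; rewrite lt_FinE; lra.
- by exists (Fin (a + 1)); split=> //; rewrite lt_FinE; lra.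
- by exists (Rev (c + 1)); split=> //; rewrite lt_RevE; lra.
- by exists (Rev ((a + c) / 2)); split=> //; rewrite lt_RevE; lra.
Qed.

Lemma finite_above x : exists2 w, w != Infty & (x < w)%O.
Proof.
case: x => [a||a]; [by exists (Rev 0) | by exists (Rev 0) |].
by exists (Rev (a - 1)); rewrite // lt_RevE; lra.
Qed.

Lemma finite_below x : exists2 w, w != Infty & (w < x)%O.
Proof.
case: x => [a||a]; [| by exists (Fin 0) | by exists (Fin 0)].
by exists (Fin (a - 1)); rewrite // lt_FinE; lra.
Qed.

Definition lower (I : interval (eline R)) := let: Interval l _ := I in l.
Definition upper (I : interval (eline R)) := let: Interval _ u := I in u.

(** The endpoint of b is at most the endpoint of b' shifted by e. Whether the
bounds are open or closed is disregarded, since diagrams do not record it. *)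
Definition bnd_le e b b' : bool :=
  match b, b' with
  | BInfty true, _ | _, BInfty false => true
  | BSide _ x, BSide _ y => (x <= shift e y)%O
  | _, _ => false
  end.

Lemma memE x (I : interval (eline R)) :
  (x \in I) = ((lower I <= BLeft x)%O && (BRight x <= upper I)%O).
Proof. by case: I => l u; rewrite itv_boundlr. Qed.

Lemma mem_convex x y z (I : interval (eline R)) :
  x \in I -> z \in I -> (x <= y)%O -> (y <= z)%O -> y \in I.
Proof.
rewrite !memE => /andP[lx _] /andP[_ zu] xy yz.
by rewrite (le_trans lx) ?bnd_simp // (le_trans _ zu) ?bnd_simp.
Qed.

Lemma le_lower c x y u : y \in Interval (BSide c x) u -> (x <= y)%O.
Proof. by rewrite memE => /andP[+ _]; case: c; rewrite ?bnd_simp // => /ltW. Qed.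

Lemma le_upper c x y l : y \in Interval l (BSide c x) -> (y <= x)%O.
Proof. by rewrite memE => /andP[_]; case: c; rewrite ?bnd_simp // => /ltW. Qed.

(** Otherwise z, or some finite w of I below z, would be shifted below J. *)
Lemma bnd_le_lower e I J z : z \in I -> shift e z \in J ->
    (forall y, y != Infty -> (y <= z)%O -> y \in I -> shift e y \in J) ->
  bnd_le e (lower J) (lower I).
Proof.
case: I J => [l u] [[c x | []] u'] //= zI zJ IJ.
have below w : (w <= z)%O -> (l <= BLeft w)%O -> w \in Interval l u.
  move: zI; rewrite !memE => /andP[_ zu] wz -> /=.
  by rewrite (le_trans _ zu) ?bnd_simp.
have shift_lt_x w : (w < shift (- e) x)%O = (shift e w < x)%O.
  by rewrite -{1}(shiftK e w) shift_lt.
case: l => [d y | []] // in zI IJ below *; last first.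
  have [w woo] := finite_below (Order.min z (shift (- e) x)).
  rewrite lt_min shift_lt_x => /andP[/ltW wz wx].
  by have := le_lower (IJ w woo wz (below _ wz isT)); rewrite leNgt wx.
rewrite /= leNgt; apply/negP; rewrite -shift_lt_x => /finite_between[w [woo yw]].
rewrite shift_lt_x => wx; have [wz | zw] := leP w z.
  have wI : w \in Interval (BSide d y) u.
    by apply: below => //; case: (d); rewrite bnd_simp // ltW.
  by have := le_lower (IJ w woo wz wI); rewrite leNgt wx.
by have := le_lower zJ; rewrite leNgt (lt_trans _ wx) // shift_lt.
Qed.

(** Otherwise some finite w above I and above z would be shifted into J. *)
Lemma bnd_le_upper e I J z : z \in I -> shift e z \in J ->
    (forall y, y != Infty -> (z <= y)%O -> shift e y \in J -> y \in I) ->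
  bnd_le e (upper J) (upper I).
Proof.
case: I J => [l [d y | []]] [l' u'] //= zI zJ IJ;
  [| by move: zI; rewrite memE andbF | by case: (u') => [|[]]].
have above w : (z <= w)%O -> (BRight (shift e w) <= u')%O ->
    shift e w \in Interval l' u'.
  move: zJ; rewrite !memE => /andP[lz _] zw -> /=.
  by rewrite andbT (le_trans lz) ?bnd_simp // shift_le.
have shift_lt_x w x : (shift (- e) x > w)%O = (shift e w < x)%O.
  by rewrite -{1}(shiftK e w) shift_lt.
case: u' => [c x | []] // in zJ IJ above *; last first.
  have [w woo] := finite_above y => yw.
  have zw : (z <= w)%O by rewrite (le_trans _ (ltW yw)) // (le_upper zI).
  by have := le_upper (IJ w woo zw (above w zw isT)); rewrite leNgt yw.
rewrite /= leNgt; apply/negP; rewrite -shift_lt_x => /finite_between[w [woo yw]].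
rewrite shift_lt_x => wx; have zw : (z <= w)%O.
  by rewrite (le_trans _ (ltW yw)) // (le_upper zI).
have wJ : shift e w \in Interval l' (BSide c x).
  by apply: above => //; case: (c); rewrite bnd_simp // ltW.
by have := le_upper (IJ w woo zw wJ); rewrite leNgt yw.
Qed.

End Line.

(** * Kinds of bars *)

Section Kinds.
Variable R : realType.
Implicit Types (e l u m : R) (c d : bool) (I J : interval (eline R)).

(** The coordinate t increases along R (c = false) and along R^o (c = true), and
the shift by e adds e to it on both ([shift_place]). *)
Definition place c (t : R) : eline R := if c then Rev (- t) else Fin t.

Definition coord c (x : eline R) : option R :=
  match c, x with
  | false, Fin a => Some a | true, Rev b => Some (- b) | _, _ => None
  end.

(** The kinds of bars are given by the parts of the line containing their
endpoints: (false, false) ordinary, (true, true) relative and (false, true)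
extended bars. *)
Definition bar_point c d I : option (R * R) :=
  if I is Interval (BSide _ x) (BSide _ y) then
    if (coord c x, coord d y) is (Some l, Some u) then Some (l, u) else None
  else None.

Lemma placeK c : pcancel (place c) (coord c).
Proof. by case: c => a //=; rewrite opprK. Qed.

Lemma coordK c x l : coord c x = Some l -> x = place c l.
Proof. by case: c x => [] [a||a] //= [<-]; rewrite ?opprK. Qed.

Lemma bar_pointP c d I l u : bar_point c d I = Some (l, u) ->
  exists s t, I = Interval (BSide s (place c l)) (BSide t (place d u)).
Proof.
case: I => [[s x|//] [t y|//]] /=.
case Ex: (coord c x) => [l'|//]; case Ey: (coord d y) => [u'|//] [<- <-].
by rewrite (coordK Ex) (coordK Ey); exists s, t.
Qed.

Lemma lt_place c l u : (place c l < place c u)%O = (l < u).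
Proof. by case: c => /=; rewrite ?lt_RevE ?lt_FinE ?ltrN2. Qed.

Lemma le_place c l u : (place c l <= place c u)%O = (l <= u).
Proof. by rewrite !leNgt lt_place. Qed.

Lemma shift_place e c l : shift e (place c l) = place c (l + e).
Proof. by case: c => //=; rewrite opprD. Qed.

Lemma place_Infty c l : place c l != Infty.
Proof. by case: c. Qed.

Lemma bar_mem c d I l u x : bar_point c d I = Some (l, u) ->
  (place c l < x)%O -> (x < place d u)%O -> x \in I.
Proof.
move=> /bar_pointP[s [t ->]] lx xu; rewrite memE /=.
by case: (s); case: (t); rewrite !bnd_simp ?ltW // lx ?xu // ltW.
Qed.

(** An endpoint can only move towards the start of the line, apart from the
shift within R or R^o; caught between two endpoints of the same part, it stays
in that part. *)
Lemma bnd_between e b c s s' l l' :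
    bnd_le e b (BSide s (place c l)) -> bnd_le e (BSide s' (place c l')) b ->
  exists t m, [/\ b = BSide t (place c m), m <= l + e & l' <= m + e].
Proof.
case: b => [t x | [] //] /= ble bge.
have [m Em] : exists m, x = place c m.
  case: c x {t} ble bge => [] [a||a] //= _ _; last by exists a.
  by exists (- a); rewrite opprK.
exists t, m; move: ble bge.
by rewrite Em !shift_place !le_place.
Qed.

Definition close e (p q : option (R * R)) : bool :=
  if (p, q) is (Some p', Some q') then
    (`|p'.1 - q'.1| <= e) && (`|p'.2 - q'.2| <= e)
  else false.

Lemma closeC e p q : close e p q = close e q p.
Proof.
by case: p q => [p|] [q|] //; rewrite /close (distrC p.1) (distrC p.2).
Qed.

(** A bar that starts in R and ends in R^o is not trivialized by any shift. *)
Definition long e c d (p : option (R * R)) : bool :=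
  if p is Some (l, u) then (c != d) || (l + e + e < u) else false.

Lemma bar_between e c d I J I' l u l' u' :
    bar_point c d I = Some (l, u) -> bar_point c d I' = Some (l', u') ->
    bnd_le e (lower J) (lower I) -> bnd_le e (upper J) (upper I) ->
    bnd_le e (lower I') (lower J) -> bnd_le e (upper I') (upper J) ->
  exists m n, bar_point c d J = Some (m, n) /\
    [/\ m <= l + e, n <= u + e, l' <= m + e & u' <= n + e].
Proof.
move=> /bar_pointP[s [t ->]] /bar_pointP[s' [t' ->]].
case: J => [bl bu] /= lJI uJI lI'J uI'J.
have [r [m [-> ml lm]]] := bnd_between (s' := s') lJI lI'J.
have [r' [n [-> nu un]]] := bnd_between (s' := t') uJI uI'J.
by exists m, n; rewrite !placeK.
Qed.

(** Being far from (l, u) means l > m + e or u > n + e, and being far from (l',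
u') means m > l' + e or n > u' + e. If these occur at different endpoints, say l
> m + e and n > u' + e, then l' < l and u' < u; if they occur at the same one,
say l > m + e and m > l' + e, then l - l' > 2 e while u' - u <= 2 e. Either way
l' + u' < l + u. *)
Lemma close_left_or_right e l u m n l' u' :
    m <= l + e -> n <= u + e -> l' <= m + e -> u' <= n + e ->
    l + u <= l' + u' ->
  close e (Some (l, u)) (Some (m, n)) || close e (Some (l', u')) (Some (m, n)).
Proof.
move=> ml nu lm un luS; rewrite /close /= !ler_distl.
case: (lerP l (m + e)) => Elm; case: (lerP u (n + e)) => Eun;
  case: (lerP m (l' + e)) => Eml; case: (lerP n (u' + e)) => Enu; lra.
Qed.

(** Extended bars overlap at every late point of R. For bars with both ends in
the same part, the interior of I meets that of I' translated by - 2 e: the only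
inequality that is not immediate is l < u' - 2 e, and its failure gives u' < u,
hence l < l' by comparison of sums, so that u' <= l + 2 e < l' + 2 e contradicts
that I' is long. *)
Lemma long_overlap e c d I I' l u l' u' : 0 < e -> c ==> d ->
    bar_point c d I = Some (l, u) -> bar_point c d I' = Some (l', u') ->
    long e c d (Some (l, u)) -> long e c d (Some (l', u')) ->
    l' <= l + e + e -> u' <= u + e + e -> l + u <= l' + u' ->
  exists x, [/\ x != Infty, x \in I & shift e (shift e x) \in I'].
Proof.
move=> e0 cd bI bI' lgI lgI' ll uu luS; have [Ecd|ncd] := eqVneq c d; last first.
  case: c d ncd cd bI bI' {lgI lgI'} => [] [] // _ _ bI bI'.
  exists (Fin (Num.max l l' + 1)); split=> //;
    [apply: (bar_mem bI) | apply: (bar_mem bI')] => //=;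
    rewrite lt_FinE; case: (lerP l l'); lra.
move: lgI lgI' bI bI'; rewrite /long -Ecd eqxx /= => lgI lgI' bI bI'.
pose lo := Num.max l (l' - e - e); pose hi := Num.min u (u' - e - e).
have [lo1 lo2] : l <= lo /\ l' - e - e <= lo by rewrite !le_max !lexx orbT.
have [hi1 hi2] : hi <= u /\ hi <= u' - e - e by rewrite !ge_min !lexx orbT.
have lohi : lo < hi by rewrite gt_max !lt_min -andbA; apply/and4P; split; lra.
exists (place c ((lo + hi) / 2)); rewrite place_Infty; split=> //.
  by apply: (bar_mem bI); rewrite lt_place; lra.
by apply: (bar_mem bI'); rewrite !shift_place lt_place; lra.
Qed.

End Kinds.

(** * Coefficients of interleaving maps *)

Section Coefficients.
Variables (F : fieldType) (R : realType) (e : R).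

(** The properties of the matrix entries of a morphism of degree e between sums
of interval modules. The point Infty is left out of the naturality square, as an
interleaving has no component there. *)
Definition coef_family (T U : finType) (I : T -> interval (eline R))
    (J : U -> interval (eline R)) (p : eline R -> T -> U -> F) : Prop :=
  (forall x i j, p x i j != 0 ->
     [/\ x != Infty, x \in I i & shift e x \in J j]) /\
  (forall x y i j, x != Infty -> y != Infty -> (x <= y)%O ->
     (x \in I i)%:R * p y i j = (shift e y \in J j)%:R * p x i j).

(** The common nonzero value of the entries p x i j, if there is one; otherwise
the value at Fin 0, which is then 0. *)
Definition coef (T U : finType) (p : eline R -> T -> U -> F) i j : F :=
  p (xget (Fin 0) [set x | p x i j != 0]%classic) i j.

Section OneFamily.
Variables (T U : finType) (I : T -> interval (eline R)).
Variables (J : U -> interval (eline R)) (p : eline R -> T -> U -> F).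
Hypothesis pIJ : coef_family I J p.

Lemma coef_family_up x y i j : p x i j != 0 -> y != Infty -> (x <= y)%O ->
  shift e y \in J j -> y \in I i /\ p y i j = p x i j.
Proof.
case: pIJ => supp nat px0 yoo xy yJ; have [xoo xI _] := supp _ _ _ px0.
have := nat x y i j xoo yoo xy; rewrite xI yJ !mul1r => pyx; split=> //.
by have [] // := supp y i j _; rewrite pyx.
Qed.

Lemma coef_family_down x y i j : p x i j != 0 -> y != Infty -> (y <= x)%O ->
  y \in I i -> shift e y \in J j /\ p y i j = p x i j.
Proof.
case: pIJ => supp nat px0 yoo yx yI; have [xoo _ xJ] := supp _ _ _ px0.
have := nat y x i j yoo xoo yx; rewrite xJ yI !mul1r => pxy; split=> //.
by have [] // := supp y i j _; rewrite -pxy.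
Qed.

Lemma coef_neq0 i j : coef p i j != 0 -> exists x, p x i j != 0.
Proof. by rewrite /coef; eexists; eassumption. Qed.

Lemma coefE x i j : x != Infty -> x \in I i -> shift e x \in J j ->
  p x i j = coef p i j.
Proof.
move=> xoo xI xJ; rewrite /coef; case: xgetP => [y _ py0 | noy].
  by have [xy|/ltW yx] := leP x y;
    [have [] := coef_family_down py0 xoo xy xI
    |have [] := coef_family_up py0 xoo yx xJ].
transitivity (0 : F); first by apply/eqP/negPn/negP; exact: noy.
by apply/esym/eqP/negPn/negP; exact: noy.
Qed.

Lemma coef_neq0_of x i j : p x i j != 0 -> coef p i j != 0.
Proof. by move=> px; have [? ? ?] := pIJ.1 _ _ _ px; rewrite -(@coefE x). Qed.

Lemma coef_lower i j : coef p i j != 0 -> bnd_le e (lower (J j)) (lower (I i)).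
Proof.
move=> /coef_neq0[z pz]; have [_ zI zJ] := pIJ.1 _ _ _ pz.
by apply: (bnd_le_lower zI zJ) => y yoo yz yI;
  have [] := coef_family_down pz yoo yz yI.
Qed.

Lemma coef_upper i j : coef p i j != 0 -> bnd_le e (upper (J j)) (upper (I i)).
Proof.
move=> /coef_neq0[z pz]; have [_ zI zJ] := pIJ.1 _ _ _ pz.
by apply: (bnd_le_upper zI zJ) => y yoo yz yJ;
  have [] := coef_family_up pz yoo yz yJ.
Qed.

End OneFamily.

Section TwoFamilies.
Variables (T U : finType) (I : T -> interval (eline R)).
Variables (J : U -> interval (eline R)).
Variables (p : eline R -> T -> U -> F) (q : eline R -> U -> T -> F).
Hypotheses (pIJ : coef_family I J p) (qJI : coef_family J I q).

(** If both factors on the left are nonzero, S x is caught between points of J,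
so that both factors are attained at x. *)
Lemma coef_prodE x i j i' : x != Infty -> x \in I i ->
    shift e (shift e x) \in I i' ->
  coef p i j * coef q j i' = p x i j * q (shift e x) j i'.
Proof.
move=> xoo xI xI'; have Sxoo : shift e x != Infty by rewrite shift_Infty.
have [p0 | pn0] := eqVneq (coef p i j) 0.
  rewrite p0 mul0r; have [-> | /(coef_neq0_of pIJ)] := eqVneq (p x i j) 0.
    by rewrite mul0r.
  by rewrite p0 eqxx.
have [q0 | qn0] := eqVneq (coef q j i') 0.
  rewrite q0 mulr0.
  have [-> | /(coef_neq0_of qJI)] := eqVneq (q (shift e x) j i') 0.
    by rewrite mulr0.
  by rewrite q0 eqxx.
suff xJ : shift e x \in J j.
  by rewrite (coefE pIJ xoo xI xJ) (coefE qJI Sxoo xJ xI').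
have [z pz] := coef_neq0 pn0; have [w qw] := coef_neq0 qn0.
have [xz | /ltW zx] := leP x z.
  by have [] := coef_family_down pIJ pz xoo xz xI.
have [xw | /ltW wx] := leP (shift e x) w; last first.
  by have [] := coef_family_up qJI qw Sxoo wx xI'.
have [_ _ zJ] := pIJ.1 _ _ _ pz; have [_ wJ _] := qJI.1 _ _ _ qw.
by apply: mem_convex zJ wJ _ xw; rewrite shift_le.
Qed.

Hypothesis pq : forall x i i', x != Infty ->
  \sum_j p x i j * q (shift e x) j i'
  = [&& i == i', x \in I i & shift e (shift e x) \in I i']%:R.

(** The sum over Y of coef p i j * coef q j i' is the Kronecker symbol when i
precedes i' for the order by l + u: nonzero terms have j in Y, and the sum over
all j can be computed at a point of the overlap of the two bars. *)
Theorem card_long_bars c d (X : {set T}) : 0 < e -> c ==> d ->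
    {in X, forall i, long e c d (bar_point c d (I i))} ->
  (#|X| <= #|nbrs (fun i j => close e (bar_point c d (I i))
                                     (bar_point c d (J j))) X|)%N.
Proof.
move=> e0 cd lgX; set near := fun i j => _; set Y := nbrs near X.
have ptX i : i \in X -> exists l u, bar_point c d (I i) = Some (l, u).
  by move=> /lgX; case: (bar_point c d (I i)) => // -[l u] _; exists l, u.
pose pos i := odflt (0, 0) (bar_point c d (I i)).
apply: (@card_le_unitriangular F T U _ R (fun i => (pos i).1 + (pos i).2) X Y
  (coef p) (coef q)) => i i' iX i'X.
have [l [u bi]] := ptX i iX; have [l' [u' bi']] := ptX i' i'X.
rewrite /pos bi bi' /= => luS.
have mid j : coef p i j * coef q j i' != 0 ->
    j \in Y /\ (l' <= l + e + e /\ u' <= u + e + e).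
  rewrite mulf_eq0 negb_or => /andP[pij qji].
  have [m [n [bj [ml nu lm un]]]] := bar_between bi bi' (coef_lower pIJ pij)
    (coef_upper pIJ pij) (coef_lower qJI qji) (coef_upper qJI qji).
  split; last by split; lra.
  apply/nbrsP; have := close_left_or_right ml nu lm un luS; rewrite -bj.
  by rewrite -bi -bi' => /orP[]; [exists i | exists i'].
have -> : \sum_(j in Y) coef p i j * coef q j i'
    = \sum_j coef p i j * coef q j i'.
  rewrite big_mkcond; apply: eq_bigr => j _; case: ifPn => // jY.
  by apply/esym/eqP/negPn/negP => /mid[jY' _]; rewrite jY' in jY.
(* If the bounds fail, all terms vanish and i <> i'. *)
have [[ll uu] | far] := pselect (l' <= l + e + e /\ u' <= u + e + e).
  have [x [xoo xI xI']] : exists x, [/\ x != Infty, x \in I i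
      & shift e (shift e x) \in I i'].
    by apply: (long_overlap e0 cd bi bi') => //; rewrite -?bi -?bi'; apply: lgX.
  under eq_bigr => j _ do rewrite (coef_prodE _ xoo xI xI').
  by rewrite pq // xI xI' !andbT.
rewrite big1 => [|j _]; last by apply/eqP/negPn/negP => /mid[_].
case: eqVneq => // Ei; case: far; subst i'.
by move: bi'; rewrite bi => -[-> ->]; split; lra.
Qed.

End TwoFamilies.

End Coefficients.

(** * Coordinates on decomposed modules *)

Section Frames.
Variables (k : fieldType) (R : realType).
Local Notation E := (eline R).
Implicit Types (V W : pmodule k R) (B : seq (interval E)).

Local Notation bar B i := (nth `]-oo, +oo[ B i).

(** Spanning vectors and coordinates of V adapted to a barcode B: at x, the
vectors of the bars containing x form a basis with dual basis the coordinates,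
while those of the other bars are zero ([fvec_notin], [fcoord_notin]). Indexing
by all naturals avoids casts between index types when B grows. *)
Record frame V B := Frame {
  fvec : forall x : E, nat -> V x;
  fcoord : forall x : E, nat -> 'Hom(V x, k^o);
  fcoordK : forall x v, v = \sum_(i < size B) fcoord x i v *: fvec x i;
  fcoord_fvec : forall x (i j : 'I_(size B)),
    fcoord x j (fvec x i) = ((i == j) && (x \in bar B i))%:R;
  ptrans_fvec : forall x y (h : (x <= y)%O) (i : 'I_(size B)),
    ptrans V h (fvec x i) = (x \in bar B i)%:R *: fvec y i }.

Lemma zero_frame : frame (zero_module k R) [::].
Proof.
exists (fun _ _ => 0) (fun _ _ => 0%VF); 
  [| by move=> x [] | by move=> x y h []].
by move=> x v; rewrite big_ord0; apply/rowP => -[].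
Qed.

Definition row_sum n (v : 'rV[k]_n) : k^o := \sum_j v 0 j.

Fact row_sum_linear n : linear (@row_sum n).
Proof.
move=> a u v; rewrite /row_sum scaler_sumr -big_split /=.
by apply: eq_bigr => j _; rewrite !mxE.
Qed.

HB.instance Definition _ n :=
  GRing.isLinear.Build k 'rV[k]_n k^o *:%R (@row_sum n) (@row_sum_linear n).

Lemma row_sum_const (b : bool) : row_sum (const_mx 1 : 'rV_b) = b%:R.
Proof.
by rewrite /row_sum; under eq_bigr do rewrite mxE; rewrite sumr_const card_ord.
Qed.

Lemma row_sum_scale (b : bool) (w : 'rV[k]_b) : w = row_sum w *: const_mx 1.
Proof.
case: b w => w; apply/rowP => j; last by case: j.
by rewrite /row_sum big_ord1 !mxE [j]ord1 mulr1.
Qed.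

Lemma const_mul_pid (a b : bool) :
  (const_mx 1 : 'rV[k]_a) *m (pid_mx 1 : 'M_(a, b)) = a%:R *: const_mx 1.
Proof.
apply/rowP => j; rewrite !mxE; case: b j => [] [] // m mb.
by case: a; rewrite ?big_ord1 ?big_ord0 ?mxE /= ?mul0r //; case: m mb.
Qed.

Lemma cons_frame (I : interval E) V B :
  frame V B -> frame (sum_module (itv_module k I) V) (I :: B).
Proof.
case=> e c cK ce te.
pose e' x i : sum_module (itv_module k I) V x :=
  if i is i'.+1 then (0, e x i') else (const_mx 1 : 'rV[k]_(x \in I), 0).
pose c' x i : 'Hom(sum_module (itv_module k I) V x, k^o) :=
  if i is i'.+1 then (c x i' \o linfun snd)%VF
  else (linfun (@row_sum (x \in I)) \o linfun fst)%VF.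
exists e' c'.
- move=> x [w v]; rewrite big_ord_recl /= comp_lfunE !lfunE /=.
  under eq_bigr => i _ do rewrite comp_lfunE lfunE.
  rewrite /=; set s := \sum_(i < _) _.
  have -> : s = (0, v).
    rewrite [in RHS](cK x v) /s; elim/big_rec2: _ => // i u1 u2 _ ->.
    by congr (_, _); rewrite /= scaler0 addr0.
  by congr (_, _); rewrite /= ?scaler0 ?addr0 ?add0r // -row_sum_scale.
- move=> x i j; rewrite /c' /e'.
  case: (unliftP ord0 i) => [i'|] ->; case: (unliftP ord0 j) => [j'|] ->;
    rewrite /= ?(inj_eq lift_inj) comp_lfunE !lfunE /= ?linear0 //.
    exact: ce.
  exact: row_sum_const.
- move=> x y h i; case: (unliftP ord0 i) => [i'|] -> /=;
    rewrite lfunE /= /sum_fun /= ?linear0; congr (_, _); rewrite /= ?scaler0 //.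
    exact: te.
  by rewrite lfunE /= const_mul_pid.
Qed.

Lemma iso_frame V W B : pisomorphic V W -> frame W B -> inhabited (frame V B).
Proof.
case=> f [nat_f bij_f] [e c cK ce te].
have fK x : cancel (f x) (f x)^-1%VF.
  by apply: lker0_lfunK; apply/lker0P; exact: bij_inj (bij_f x).
have fVK x : cancel (f x)^-1%VF (f x).
  by move=> w; have [g _ gK] := bij_f x; rewrite -{1}(gK w) fK gK.
split; exists (fun x i => (f x)^-1%VF (e x i)) (fun x i => (c x i \o f x)%VF).
- move=> x v; apply: (can_inj (fK x)); rewrite linear_sum [LHS]cK.
  by apply: eq_bigr => i _; rewrite linearZ /= fVK comp_lfunE.
- by move=> x i j; rewrite comp_lfunE fVK ce.
- move=> x y h i; apply: (can_inj (fK y)); rewrite -comp_lfunE -nat_f.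
  by rewrite comp_lfunE fVK te linearZ /= fVK.
Qed.

Lemma decomposition_frame V B : is_decomposition V B -> inhabited (frame V B).
Proof.
case=> _ iso_VB; apply: iso_frame iso_VB _.
by elim: B {V} => [|I B IHB] /=; [exact: zero_frame | exact: cons_frame].
Qed.

End Frames.

(** * Interleavings in coordinates *)

Section ShiftMaps.
Variables (k : fieldType) (R : realType) (e : R).
Local Notation E := (eline R).
Implicit Types (V W : pmodule k R) (B C : seq (interval E)).

(** The zero component at Infty only serves to make the family total: it is not
natural there. *)
Definition shift_at (V W : pmodule k R) (phi : shift_map e V W) (x : E) :
    'Hom(V x, W (shift e x)) :=
  match x with
  | Fin a => shF phi a | Infty => 0%VF | Rev b => shR phi b
  end.

Lemma shift_at_natural (V W : pmodule k R) (phi : shift_map e V W) (x y : E)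
    (h : (x <= y)%O) (h' : (shift e x <= shift e y)%O) :
  x != Infty -> y != Infty ->
  (ptrans W h' \o shift_at phi x = shift_at phi y \o ptrans V h)%VF.
Proof.
move=> xoo yoo; have [Exy|nxy] := eqVneq x y.
  by subst y; rewrite !ptrans_id comp_lfun1l comp_lfun1r.
have ltxy : (x < y)%O by rewrite lt_neqAle nxy.
case: x y xoo yoo {nxy} h h' ltxy => [a||a] [c||c] //= _ _ h h' ltxy.
- exact: shFF.
- exact: shFR.
- exact: shRR.
Qed.

Lemma shift_at_inverse (V W : pmodule k R) (phi : shift_map e V W)
    (psi : shift_map e W V) (x : E) (h : (x <= shift e (shift e x))%O) :
  shift_inverse phi psi -> x != Infty ->
  (shift_at psi (shift e x) \o shift_at phi x)%VF = ptrans V h.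
Proof. by case=> invF invR; case: x h. Qed.

Local Notation bar B i := (nth `]-oo, +oo[ B i).

Section Coordinates.
Variables (V W : pmodule k R) (B C : seq (interval E)).
Variables (fV : frame V B) (fW : frame W C).

Definition shift_coef (phi : shift_map e V W) (x : E)
    (i : 'I_(size B)) (j : 'I_(size C)) : k :=
  fcoord fW (shift e x) j (shift_at phi x (fvec fV x i)).

End Coordinates.

Lemma fvec_notin V B (fV : frame V B) (x : E) (i : 'I_(size B)) :
  x \notin bar B i -> fvec fV x i = 0.
Proof.
move=> xB; have := ptrans_fvec fV (lexx x) i.
by rewrite ptrans_id id_lfunE (negPf xB) scale0r.
Qed.

Lemma fcoord_notin V B (fV : frame V B) (x : E) (i : 'I_(size B)) v :
  x \notin bar B i -> fcoord fV x i v = 0.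
Proof.
move=> xB; rewrite (fcoordK fV v) linear_sum big1 // => j _.
rewrite linearZ /= fcoord_fvec; case: eqP => [->|_]; last exact: mulr0.
by rewrite (negPf xB); exact: mulr0.
Qed.

Lemma shift_coef_sum V W B C (fV : frame V B) (fW : frame W C)
    (phi : shift_map e V W) (x : E) (i : 'I_(size B)) :
  shift_at phi x (fvec fV x i)
  = \sum_j shift_coef fV fW phi x i j *: fvec fW (shift e x) j.
Proof. exact: fcoordK. Qed.

Lemma shift_coef_family V W B C (fV : frame V B) (fW : frame W C)
    (phi : shift_map e V W) :
  coef_family e (fun i : 'I_(size B) => bar B i)
    (fun j : 'I_(size C) => bar C j) (shift_coef fV fW phi).
Proof.
split=> [x i j | x y i j xoo yoo xy].
  move=> p0; split.
  - by apply: contraNneq p0 => ->; rewrite /shift_coef /= lfunE /= linear0.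
  - by apply: contraNT p0 => /fvec_notin xB; rewrite /shift_coef xB !linear0.
  - by apply: contraNT p0 => /fcoord_notin xC; rewrite /shift_coef xC.
have Sxy : (shift e x <= shift e y)%O by rewrite shift_le.
have /lfunP/(_ (fvec fV x i)) := shift_at_natural phi xy Sxy xoo yoo.
rewrite !comp_lfunE ptrans_fvec linearZ /= => /(congr1 (fcoord fW (shift e y) j)).
rewrite linearZ /= => Ey; apply: etrans (esym Ey) _.
rewrite (shift_coef_sum fV fW) !linear_sum (bigD1 j) //= big1 => [|j' j'j].
  rewrite addr0 !linearZ /= ptrans_fvec linearZ /= fcoord_fvec eqxx /=.
  rewrite -[LHS]/(_ * (_ * _)).
  have [xC | /fcoord_notin xC] := boolP (shift e x \in bar C j).
    by rewrite mul1r mulrC.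
  by rewrite /shift_coef xC mul0r mulr0.
by rewrite !linearZ /= ptrans_fvec linearZ /= fcoord_fvec (negPf j'j) !scaler0.
Qed.

(** The entry (i, i') of psi o phi = V_(x, SSx). *)
Lemma shift_coef_inverse V W B C (fV : frame V B) (fW : frame W C)
    (phi : shift_map e V W) (psi : shift_map e W V) (x : E)
    (i i' : 'I_(size B)) : 0 < e -> shift_inverse phi psi -> x != Infty ->
  \sum_j shift_coef fV fW phi x i j * shift_coef fW fV psi (shift e x) j i'
  = [&& i == i', x \in bar B i & shift e (shift e x) \in bar B i']%:R.
Proof.
move=> e0 inv xoo; have h : (x <= shift e (shift e x))%O.
  by rewrite (le_trans (le_shift _ (ltW e0))) // le_shift // ltW.
have /lfunP/(_ (fvec fV x i)) := shift_at_inverse h inv xoo.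
rewrite comp_lfunE ptrans_fvec (shift_coef_sum fV fW) linear_sum.
move=> /(congr1 (fcoord fV (shift e (shift e x)) i')).
rewrite linear_sum linearZ /= fcoord_fvec; under eq_bigr do rewrite !linearZ.
move=> ->; rewrite -[LHS]/(_ * _).
case: eqVneq => [<-|]; rewrite ?mulr0 //.
by case: (x \in _); rewrite ?mul1r ?mul0r.
Qed.

End ShiftMaps.

(** * Matching the points of one kind *)

Lemma pmatching_of_matching (R : realType) (T U : finType) (f : T -> R * R)
    (g : U -> R * R) (A : {set T}) (B : {set U}) (M : {set T * U}) :
  matching M -> {in M, forall e, e.1 \in A} -> {in M, forall e, e.2 \in B} ->
  exists m : pmatching [seq f i | i <- enum A] [seq g j | j <- enum B],
    [/\ matched m = [seq (f e.1, g e.2) | e <- enum M],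
        unmatchedl m = [seq f i | i <- enum (A :\: fst @: M)]
      & unmatchedr m = [seq g j | j <- enum (B :\: snd @: M)]].
Proof.
move=> [fst_inj snd_inj] MA MB.
have split_enum (S : finType) (C : {set S}) (h : T * U -> S) :
    {in M &, injective h} -> {in M, forall e, h e \in C} ->
  perm_eq (enum C) ([seq h e | e <- enum M] ++ enum (C :\: h @: M)).
  move=> h_inj hC; apply: uniq_perm; first exact: enum_uniq.
    rewrite cat_uniq enum_uniq andbT map_inj_in_uniq ?enum_uniq //=; last first.
      by move=> e1 e2; rewrite !mem_enum; apply: h_inj.
    apply/hasPn => x; rewrite mem_enum inE => /andP[xM _]; apply: contra xM.
    by case/mapP => e; rewrite mem_enum => eM ->; apply: imset_f.
  move=> x; rewrite mem_cat !mem_enum inE; apply/idP/orP => [xC | [|/andP[]//]].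
    case: (boolP (x \in h @: M)) => [/imsetP[e eM ->] | xM]; [left | by right].
    by apply/mapP; exists e; rewrite ?mem_enum.
  by case/mapP => e; rewrite mem_enum => /hC eC ->.
have permA := perm_map f (split_enum _ _ _ fst_inj MA).
have permB := perm_map g (split_enum _ _ _ snd_inj MB).
rewrite map_cat -map_comp in permA; rewrite map_cat -map_comp in permB.
pose s := [seq (f e.1, g e.2) | e <- enum M].
have unzip1s : unzip1 s = map (f \o fst) (enum M) by rewrite /unzip1 -map_comp.
have unzip2s : unzip2 s = map (g \o snd) (enum M) by rewrite /unzip2 -map_comp.
rewrite -unzip1s in permA; rewrite -unzip2s in permB.
by exists (PMatching permA permB).
Qed.

Lemma pmap_enum (X Y : Type) (x0 : X) (y0 : Y) (h : X -> option Y) (s : seq X) :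
  pmap h s = [seq odflt y0 (h (nth x0 s i))
             | i : 'I_(size s) <- enum [set i : 'I_(size s) | h (nth x0 s i)]].
Proof.
have -> : enum [set i : 'I_(size s) | h (nth x0 s i)]
    = [seq i : 'I_(size s) <- enum 'I_(size s) | h (nth x0 s i)].
  by rewrite {1}/enum_mem enumT; apply: eq_filter => i; rewrite /= inE.
rewrite -{1}(mkseq_nth x0 s) /mkseq -val_enum_ord -map_comp.
by elim: (enum _) => //= i t ->; case Ei: (h _) => [y|] //=; rewrite Ei.
Qed.

(** The diagonal point at the midpoint realizes the bound. *)
Lemma dist_diag_le (R : realType) (e : R) (p : R * R) :
  `|p.1 - p.2| <= e + e -> dist_diag p <= e.
Proof.
move=> pe; pose z := (p.1 + p.2) / 2.
apply: (@le_trans _ _ (dist_linf p (z, z))).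
  apply: ge_inf; last by exists z.
  by exists 0 => _ [w _ <-]; rewrite le_max normr_ge0.
rewrite ge_max /=; move: pe; rewrite !ler_norml /z => /andP[? ?].
by apply/andP; split; apply/andP; split; lra.
Qed.

Section KindMatching.
Variables (k : fieldType) (R : realType) (e : R).
Implicit Types (V W : pmodule k R) (B C : seq (interval (eline R))).
Implicit Types (c d : bool) (I J : interval (eline R)).

Local Notation bar B i := (nth `]-oo, +oo[ B i).

(** The planes of the diagrams use the label b of Rev b, the opposite of the
increasing coordinate of [place]. *)
Definition flip c (t : R) : R := if c then - t else t.

Definition kind_point c d I : option (R * R) :=
  omap (fun p => (flip c p.1, flip d p.2)) (bar_point c d I).

Lemma ord_pointE : @ord_point R =1 kind_point false false.
Proof. by case=> [[s [a||a]|[]] [t [b||b]|[]]]. Qed.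

Lemma rel_pointE : @rel_point R =1 kind_point true true.
Proof.
by case=> [[s [a||a]|[]] [t [b||b]|[]]] //; rewrite /kind_point /= !opprK.
Qed.

Lemma ext_pointE : @ext_point R =1 kind_point false true.
Proof.
by case=> [[s [a||a]|[]] [t [b||b]|[]]] //; rewrite /kind_point /= !opprK.
Qed.

Lemma dist_flip c (t u : R) : `|flip c t - flip c u| = `|t - u|.
Proof. by case: c => //=; rewrite -opprD normrN. Qed.

Lemma close_dist c d I J p q : close e (bar_point c d I) (bar_point c d J) ->
  kind_point c d I = Some p -> kind_point c d J = Some q -> dist_linf p q <= e.
Proof.
rewrite /kind_point /close.
case: bar_point => [[l u]|] //; case: bar_point => [[l' u']|] // lu [<-] [<-].
by rewrite ge_max /= !dist_flip.
Qed.

Lemma short_dist_diag c d I p : (exists x, x \in I) ->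
    ~~ long e c d (bar_point c d I) -> kind_point c d I = Some p ->
  c = d /\ dist_diag p <= e.
Proof.
move=> [x xI]; rewrite /kind_point.
case EI: bar_point => [[l u]|] //=; rewrite negb_or negbK -leNgt.
move=> /andP[/eqP Ecd lu] [<-]; subst d; split=> //.
apply: dist_diag_le; rewrite dist_flip distrC ger0_norm; first by lra.
have [s [t EI']] := bar_pointP EI; rewrite {}EI' in xI.
by rewrite subr_ge0 -(le_place c) (le_trans (le_lower xI)) ?(le_upper xI).
Qed.

Lemma card_long_le V W B C (phi : shift_map e V W) (psi : shift_map e W V) c d
    (X : {set 'I_(size B)}) :
    0 < e -> c ==> d -> is_decomposition V B -> is_decomposition W C ->
    shift_inverse phi psi ->
    {in X, forall i : 'I_(size B), long e c d (bar_point c d (bar B i))} ->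
  (#|X| <= #|nbrs (fun (i : 'I_(size B)) (j : 'I_(size C)) =>
    close e (bar_point c d (bar B i)) (bar_point c d (bar C j))) X|)%N.
Proof.
move=> e0 cd /decomposition_frame[fV] /decomposition_frame[fW] inv lgX.
apply: (card_long_bars (shift_coef_family fV fW phi)
  (shift_coef_family fW fV psi) _ e0 cd lgX) => x i i' xoo.
exact: shift_coef_inverse.
Qed.

(** Unmatched points come from bars that are not long; there are none among the
extended bars. *)
Lemma kind_matching V W B C c d :
    0 < e -> c ==> d -> is_decomposition V B -> is_decomposition W C ->
    interleaved e V W ->
  exists m : pmatching (pmap (kind_point c d) B) (pmap (kind_point c d) C),
    Defs.within e m /\ (c != d -> perfect m).
Proof.
move=> e0 cd dB dC [phi [psi [inv inv']]].
rewrite !(pmap_enum `]-oo, +oo[ (0, 0)).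
set SB := [set i | _]; set SC := [set i | _].
pose r (i : 'I_(size B)) (j : 'I_(size C)) :=
  close e (bar_point c d (bar B i)) (bar_point c d (bar C j)).
have [||M [mM rM cB cC]] := @two_sided_hall _ _ r
    [set i : 'I_(size B) | long e c d (bar_point c d (bar B i))]
    [set j : 'I_(size C) | long e c d (bar_point c d (bar C j))].
- move=> X /subsetP lgX; apply: (card_long_le e0 cd dB dC inv) => i /lgX.
  by rewrite inE.
- move=> Y /subsetP lgY.
  rewrite (_ : nbrs _ Y = nbrs (fun (j : 'I_(size C)) (i : 'I_(size B)) =>
      close e (bar_point c d (bar C j)) (bar_point c d (bar B i))) Y).
    by apply: (card_long_le e0 cd dC dB inv') => j /lgY; rewrite inE.
  by apply/setP => i; apply/nbrsP/nbrsP => -[j jY rij];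
    exists j; rewrite // /r closeC.
have kindB i j : r i j -> i \in SB /\ j \in SC.
  rewrite /r /SB /SC !inE /kind_point.
  by case: bar_point => [?|]; case: bar_point => [?|].
have [|e1 eM|m [matchedE unmatchedlE unmatchedrE]] := @pmatching_of_matching R _ _
    (fun i : 'I_(size B) => odflt (0, 0) (kind_point c d (bar B i)))
    (fun j : 'I_(size C) => odflt (0, 0) (kind_point c d (bar C j))) SB SC M mM.
- by move=> e1 /rM/kindB[].
- by have [] := kindB _ _ (rM _ eM).
exists m.
have restl p : p \in unmatchedl m -> c = d /\ dist_diag p <= e.
  rewrite unmatchedlE => /mapP[i]; rewrite mem_enum => /setDP[iB iM] ->.
  move: iB; rewrite inE; case Ei: kind_point => [q|] // _.
  apply: short_dist_diag Ei.
    by case: dB => dB _; apply: (dB _ _).1; apply: mem_nth.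
  by apply: contra iM => lgi; apply: (subsetP cB); rewrite inE.
have restr p : p \in unmatchedr m -> c = d /\ dist_diag p <= e.
  rewrite unmatchedrE => /mapP[i]; rewrite mem_enum => /setDP[iC iM] ->.
  move: iC; rewrite inE; case Ei: kind_point => [q|] // _.
  apply: short_dist_diag Ei.
    by case: dC => dC _; apply: (dC _ _).1; apply: mem_nth.
  by apply: contra iM => lgi; apply: (subsetP cC); rewrite inE.
split; first split.
- move=> pq; rewrite matchedE => /mapP[[i j]]; rewrite mem_enum => eM -> /=.
  have /= rij := rM _ eM; have [] := kindB _ _ rij; rewrite !inE.
  case Ei: (kind_point c d (bar B i)) => [p|] // _.
  case Ej: (kind_point c d (bar C j)) => [q|] // _.
  exact: close_dist rij Ei Ej.
- by move=> p /restl[].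
- by move=> p /restr[].
move=> ncd; split.
  case: (unmatchedl m) restl => // p s /(_ p (mem_head _ _))[Ecd _].
  by rewrite Ecd eqxx in ncd.
case: (unmatchedr m) restr => // p s /(_ p (mem_head _ _))[Ecd _].
by rewrite Ecd eqxx in ncd.
Qed.

End KindMatching.

Theorem theorem6p8 (k : fieldType) (R : realType) (eps : R) (V W : pmodule k R)
    (heps : 0 < eps) (hV : decomposable V) (hW : decomposable W)
    (hVW : interleaved eps V W) :
  (bottleneck V W <= eps%:E)%E.
Proof.
apply: ereal_inf_lbound; exists eps => //; split=> //.
have dV : is_decomposition V (barcode V).
  by rewrite /barcode; case: xgetP => // noB; case: hV => B /noB.
have dW : is_decomposition W (barcode W).
  by rewrite /barcode; case: xgetP => // noB; case: hW => B /noB.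
rewrite /delta_matched /Ord /Rel /Ext.
rewrite !(eq_pmap (@ord_pointE R)) !(eq_pmap (@rel_pointE R)).
rewrite !(eq_pmap (@ext_pointE R)).
have [mO [wO _]] := kind_matching heps (isT : false ==> false) dV dW hVW.
have [mR [wR _]] := kind_matching heps (isT : true ==> true) dV dW hVW.
have [mE [wE /(_ isT) pE]] := kind_matching heps (isT : false ==> true) dV dW hVW.
by exists mO, mR, mE.
Qed.
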